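(* Let $H^\omega$, $\Lambda_L$, $H^\omega_{\Lambda_L}$, $\beta_L$, $\gamma_L$ be as in the context, with $\alpha>0$, $\delta>1$ and $d-\alpha(\delta-1)>0$. If $M_1<-2d$ and $M_2>2d$, then $$\limsup_{L\to\infty}\gamma_L\big((-\infty,M_1]\cup[M_2,\infty)\big)\le\frac12\left[\frac{1}{(-2d-M_1)^{\delta-1}}+\frac{1}{(M_2-2d)^{\delta-1}}\right].$$ Moreover, for any interval $I\subseteq\mathbb{R}\setminus[-2d,2d]$ of length $|I|>4d$ there is a constant $C_I>0$ such that $$\liminf_{L\to\infty}\gamma_L(I)\ge C_I>0.$$
   Context: Let $d\ge1$ be an integer. Let $\{q_n\}_{n\in\mathbb{Z}^d}$ be i.i.d. real random variables on a probability space $(\Omega,\mathcal{B},\mathbb{P})$ (expectation $\mathbb{E}$), whose common distribution $\mu$ has density $\rho(x)=0$ for $|x|<1$ and $\rho(x)=\frac{\delta-1}{2}|x|^{-\delta}$ for $|x|\ge1$, for some $\delta>1$. Let $\{a_n\}_{n\in\mathbb{Z}^d}$ be positive reals with $a_n\simeq|n|^{-\alpha}$, $\alpha>0$ (i.e. there are constants $0<c_1\le c_2$ with $c_1|n|^{-\alpha}\le a_n\le c_2|n|^{-\alpha}$ for all $n\ne0$; $|\cdot|$ is the Euclidean norm). Assume $d-\alpha(\delta-1)>0$. On $\ell^2(\mathbb{Z}^d)$, with standard basis $\{\delta_n\}$, let $(\Delta u)(n)=\sum_{|m-n|=1}u(m)$ and $H^\omega=-\Delta+V^\omega$, where $(V^\omega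 u)(n)=a_nq_n(\omega)u(n)$. For $L\in\mathbb{N}$ let $\Lambda_L=\{n\in\mathbb{Z}^d:|n_i|\le L,\ i=1,\dots,d\}$ and let $H^\omega_{\Lambda_L}$ be the finite symmetric matrix $(\langle\delta_n,H^\omega\delta_m\rangle)_{n,m\in\Lambda_L}$. Put $\beta_L=\sum_{n\in\Lambda_L}a_n^{\delta-1}$ (which tends to $\infty$ as $L\to\infty$). Define the Borel measure $\gamma_L(\cdot)=\frac{1}{\beta_L}\sum_{n\in\Lambda_L}\mathbb{E}\big(\langle\delta_n,E_{H^\omega_{\Lambda_L}}(\cdot)\delta_n\rangle\big)$ on $\mathbb{R}$, where $E_{H^\omega_{\Lambda_L}}$ is the spectral projection-valued measure of $H^\omega_{\Lambda_L}$; equivalently $\gamma_L(B)$ is $\beta_L^{-1}$ times the expected number of eigenvalues of $H^\omega_{\Lambda_L}$ in $B$, counted with multiplicity. *)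

(* Defs.v *)
From HB Require Import structures.
From mathcomp Require Import all_boot all_order all_algebra finmap.
From mathcomp Require Import all_classical all_reals all_analysis.

Set Implicit Arguments.
Unset Strict Implicit.
Unset Printing Implicit Defensive.

Import Order.TTheory GRing.Theory Num.Theory.
Import numFieldNormedType.Exports.

Local Open Scope fset_scope.
Local Open Scope classical_set_scope.
Local Open Scope ring_scope.

(* Z^d is the type 'rV[int]_d of integer row vectors. *)

Definition enorm (R : realType) (d : nat) (n : 'rV[int]_d) : R :=
  Num.sqrt (\sum_(i < d) (n 0 i)%:~R ^+ 2).
Arguments enorm R {d} n.

Definition box (d L : nat) : {fset 'rV[int]_d} :=
  [fset (\row_(i < d) ((f i)%:Z - L%:Z))
    | f : {ffun 'I_d -> 'I_(L.*2.+1)} in predT].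

Lemma in_box (d L : nat) (n : 'rV[int]_d) :
  (n \in box d L) = [forall i, `|n 0 i| <= L%:Z].
Proof.
apply/imfsetP/forallP => [[f _ ->] i|nL].
  rewrite mxE; case: (f i) => k /=; rewrite ltnS => kL.
  rewrite ler_norml lerBlDr lerBrDr addrC subrr -PoszD addnn.
  by rewrite !lez_nat kL leq0n.
have h i : (`|(n 0 i + L%:Z)%R|%N < L.*2.+1)%N.
  have := nL i; rewrite ler_norml => /andP[n1 n2].
  rewrite ltnS -lez_nat gez0_abs; last by rewrite -lerBlDr sub0r.
  by rewrite -addnn PoszD lerD2r.
exists [ffun i => Ordinal (h i)]; first by rewrite inE.
apply/rowP => i; rewrite mxE ffunE /= gez0_abs ?addrK//.
by have := nL i; rewrite ler_norml => /andP[n1 _]; rewrite -lerBlDr sub0r.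
Qed.

Definition dirac_vec (R : realType) (d : nat) (m n : 'rV[int]_d) : R :=
  (n == m)%:R.
Arguments dirac_vec R {d} m n.

Definition laplacian (R : realType) (d : nat) (u : 'rV[int]_d -> R) :
    'rV[int]_d -> R :=
  fun n => \sum_(m \in [set m | enorm R (m - n) = 1]) u m.

(* The sum in [laplacian] is over a finite set, so it is never truncated. *)
Lemma finite_neighbours (R : realType) (d : nat) (n : 'rV[int]_d) :
  finite_set [set m | enorm R (m - n) = 1].
Proof.
apply: (@sub_finite_set _ _ ((fun k => k + n) @` [set` box d 1])); last first.
  exact/finite_image/finite_fset.
move=> m /= mn1; exists (m - n); last by rewrite subrK.
rewrite /= in_box; apply/forallP => i.
have s0 : 0 <= \sum_(j < d) ((m - n) 0 j)%:~R ^+ 2 :> R.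
  by apply: sumr_ge0 => j _; exact: sqr_ge0.
have s1 : \sum_(j < d) ((m - n) 0 j)%:~R ^+ 2 = 1 :> R.
  by rewrite -(sqr_sqrtr s0) [Num.sqrt _]mn1 expr1n.
have : ((m - n) 0 i)%:~R ^+ 2 <= 1 :> R.
  rewrite -[leRHS]s1 (bigD1 i)//= lerDl.
  by apply: sumr_ge0 => j _; exact: sqr_ge0.
by rewrite -real_normK ?num_real// expr_le1// -intr_norm lerz1.
Qed.

Definition hamiltonian (R : realType) (d : nat) (a q : 'rV[int]_d -> R)
    (u : 'rV[int]_d -> R) : 'rV[int]_d -> R :=
  fun n => - laplacian u n + a n * q n * u n.

(* The matrix (<delta_n, A delta_m>), as <delta_n, u> = u n. *)
Definition finite_volume (R : realType) (d : nat) (D : {fset 'rV[int]_d})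
    (A : ('rV[int]_d -> R) -> 'rV[int]_d -> R) : 'M[R]_#|{: D}| :=
  \matrix_(i, j) A (dirac_vec R (val (enum_val j))) (val (enum_val i)).

(* Projection onto the row space of U along its orthogonal complement
   {v | v *m U^T = 0}; matrices act on row vectors, as for [eigenspace]. *)
Definition orthoproj (R : realType) (k : nat) (U : 'M[R]_k) : 'M[R]_k :=
  proj_mx U (kermx U^T).

(* E_A(B), for a symmetric matrix A. *)
Definition spectral_measure (R : realType) (k : nat) (A : 'M[R]_k)
    (B : set R) : 'M[R]_k :=
  \sum_(x \in [set x | eigenvalue A x] `&` B) orthoproj (eigenspace A x).

Definition betaL (R : realType) (d : nat) (a : 'rV[int]_d -> R) (delta : R)
    (L : nat) : R :=
  \sum_(n <- box d L) a n `^ (delta - 1).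

Definition gammaL (R : realType) (d : nat) (disp : measure_display)
    (Omega : measurableType disp) (P : probability Omega R)
    (a : 'rV[int]_d -> R) (q : 'rV[int]_d -> Omega -> R) (delta : R)
    (L : nat) (B : set R) : \bar R :=
  (((betaL a delta L)^-1)%:E *
   \sum_(n : box d L)
     'E_P[fun w => spectral_measure
            (finite_volume (box d L) (hamiltonian a (fun m => q m w))) B
            (enum_rank n) (enum_rank n)])%E.

Definition mutually_independent (R : realType) (disp : measure_display)
    (Omega : measurableType disp) (P : probability Omega R) (K : choiceType)
    (X : K -> {RV P >-> R}) : Prop :=
  forall (J : {fset K}) (B : K -> set R),
    (forall i, i \in J -> measurable (B i)) ->
    P (\bigcap_(i in [set` J]) (X i @^-1` B i)) =
    (\prod_(i <- J) P (X i @^-1` B i))%E.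

Definition rho (R : realType) (delta x : R) : R :=
  if `|x| < 1 then 0 else (delta - 1) / 2 * `|x| `^ (- delta).

(* Main.v *)
Require Import Defs.
From HB Require Import structures.
From mathcomp Require Import all_boot all_order all_algebra finmap.
From mathcomp Require Import all_classical all_reals all_analysis.
From mathcomp Require Import measurable_realfun.
From mathcomp Require complex spectral.
From mathcomp Require Import ring lra.

(* Write H for the finite-volume matrix: a diagonal matrix V plus an operator K
   of norm at most 2d (Schur test) whose rows have squared norm at most 2d.

   Upper bound: by Weyl's inequality, in the form of a dimension count, H has at
   most as many eigenvalues in [M2, oo) as V has entries in [M2 - 2d, oo), and
   symmetrically on the left.  The expected number of such entries is bounded by
   the Pareto tails P(a q >= s) <= s^(1 - delta) a^(delta - 1) / 2, whose sum
   over the box is proportional to beta_L; so the bound holds for every L.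

   Lower bound: choose J so that every point at distance less than 2d from J
   lies in I.  If V_n is in J, then ||(H - V_n) delta_n||^2 <= 2d, and
   Chebyshev's inequality gives
   <delta_n, E_H(I) delta_n> >= 1 - 2d / (2d)^2 >= 1/2.  For all n outside a
   fixed box, a_n is so small that P(V_n in J) is a fixed positive multiple of
   a_n^(delta - 1).

   Monotonicity and superadditivity of the lower integral replace a proof that
   the spectral quantities are measurable in the randomness. *)

Set Implicit Arguments.
Unset Strict Implicit.
Unset Printing Implicit Defensive.

Import Order.TTheory GRing.Theory Num.Theory.
Import numFieldNormedType.Exports.

Local Open Scope classical_set_scope.
Local Open Scope ring_scope.

(** * The real spectral theorem and eigenvalue counting *)

Section RowDot.
Variable R : realFieldType.

Lemma mulmx_trE n (u v : 'rV[R]_n) : (u *m v^T) 0 0 = \sum_i u 0 i * v 0 i.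
Proof. by rewrite mxE; apply: eq_bigr => i _; rewrite mxE. Qed.

Lemma sqnorm_eq0 n (u : 'rV[R]_n) : ((u *m u^T) 0 0 == 0) = (u == 0).
Proof.
rewrite mulmx_trE psumr_eq0; last by move=> i _; rewrite -expr2; exact: sqr_ge0.
apply/allP/eqP => [u0|-> i _]; last by rewrite mxE mulr0 eqxx.
apply/rowP => i; have := u0 i; rewrite mem_index_enum mxE => /(_ isT)/=.
by rewrite mulf_eq0 orbb => /eqP.
Qed.

Lemma sqnorm_ge0 n (u : 'rV[R]_n) : 0 <= (u *m u^T) 0 0.
Proof.
rewrite mulmx_trE; apply: sumr_ge0 => i _; rewrite -expr2; exact: sqr_ge0.
Qed.

Lemma sqnorm_gt0 n (u : 'rV[R]_n) : u != 0 -> 0 < (u *m u^T) 0 0.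
Proof. by move=> u0; rewrite lt_neqAle sqnorm_ge0 eq_sym sqnorm_eq0 u0. Qed.

Lemma mulmx_tr_comm n (u v : 'rV[R]_n) : u *m v^T = v *m u^T.
Proof.
by rewrite -[LHS]trmxK trmx_mul trmxK [LHS]mx11_scalar mxE -mx11_scalar.
Qed.

(* The Householder reflection along [w], with the junk value [1] at [w = 0]. *)
Definition householder n (w : 'rV[R]_n) : 'M[R]_n :=
  1%:M - (2 / (w *m w^T) 0 0) *: (w^T *m w).

Lemma householder_sym n (w : 'rV[R]_n) : (householder w)^T = householder w.
Proof.
by rewrite linearB/= linearZ/= trmx_mul trmxK trmx1.
Qed.

Lemma householderK n (w : 'rV[R]_n) : householder w *m householder w = 1%:M.
Proof.
rewrite /householder; set c := 2 / _.
have [->|w0] := eqVneq w 0.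
  by rewrite mulmx0 scaler0 subr0 mulmx1.
have nw : (w *m w^T) 0 0 != 0 by rewrite sqnorm_eq0.
rewrite mulmxBr mulmx1 mulmxBl mul1mx -scalemxAr -scalemxAl.
rewrite mulmxA -(mulmxA w^T) [w *m w^T]mx11_scalar mul_mx_scalar -scalemxAl.
rewrite !scalerA -mulrA [_ * (w *m _) 0 0]mulrC.
have -> : c * ((w *m w^T) 0 0 * c) = 2 * c.
  by rewrite mulrA [c * _]mulfVK.
rewrite mulrDl mul1r scalerDl [X in _ - X](_ : _ = - (c *: (w^T *m w))).
  by rewrite opprK subrK.
by rewrite opprD addrA subrr sub0r.
Qed.

(** For vectors of equal norm the reflection along [u - v] exchanges them. If [u = v], the default
    value of [householder] at 0 is the identity, as it should be. *)
Lemma householder_swap n (u v : 'rV[R]_n) :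
  u *m u^T = v *m v^T -> u *m householder (u - v) = v.
Proof.
move=> uv; rewrite /householder.
have [/eqP|w0] := eqVneq (u - v) 0.
  rewrite subr_eq0 => /eqP ->.
  by rewrite subrr mulmx0 scaler0 subr0 mulmx1.
have := w0; rewrite -sqnorm_eq0; set w := u - v => nw.
(* Equal norms give |w|^2 = 2 <u, w>, so the reflection subtracts exactly [w] from [u]. *)
have e : (w *m w^T) 0 0 = 2 * (u *m w^T) 0 0.
  rewrite /w linearB/= mulmxBl !mulmxBr -uv (mulmx_tr_comm v u).
  rewrite !mxE; ring.
rewrite mulmxBr mulmx1 -scalemxAr mulmxA [u *m w^T]mx11_scalar mul_scalar_mx.
rewrite scalerA.
have -> : 2 / (w *m w^T) 0 0 * (u *m w^T) 0 0 = 1.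
  by rewrite mulrAC -e divff.
by rewrite scale1r /w subKr.
Qed.

End RowDot.

Section SpectralTheorem.
Import complex.
Local Open Scope complex_scope.
Variable R : rcfType.

(* A complex eigenvector [u + i w] with eigenvalue [a + i b] satisfies
   [u A = a u - b w] and [w A = b u + a w], and the symmetry of [A] forces
   [b (|u|^2 + |w|^2) = 0]. *)
Lemma symmetric_eigenvector n (A : 'M[R]_n.+1) : A^T = A ->
  exists a (v : 'rV[R]_n.+1), v *m v^T = 1%:M /\ v *m A = a *: v.
Proof.
move=> Asym.
pose Re := @complex.Re R : R[i] -> R; pose Im := @complex.Im R : R[i] -> R.
have ReD x y : Re (x + y) = Re x + Re y by case: x y => [? ?] [].
have ImD x y : Im (x + y) = Im x + Im y by case: x y => [? ?] [].
have Re0 : Re 0 = 0 by [].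
have Im0 : Im 0 = 0 by [].
pose f : {rmorphism R -> R[i]} := complex.real_complex R.
have [z /eigenvalueP[v vA v0]] :=
  spectral.eigenvalue_closed (map_mx f A) (ltn0Sn n).
pose u := map_mx Re v; pose w := map_mx Im v.
have uA : u *m A = Re z *: u - Im z *: w.
  apply/rowP => j; transitivity (Re ((v *m map_mx f A) 0 j)).
    rewrite !mxE (big_morph Re ReD Re0); apply: eq_bigr => i _.
    by rewrite !mxE; case: (v 0 i) => x y; rewrite /Re/= mulr0 subr0.
  by rewrite vA !mxE; case: (v 0 j) => x y; case: (z).
have wA : w *m A = Im z *: u + Re z *: w.
  apply/rowP => j; transitivity (Im ((v *m map_mx f A) 0 j)).
    rewrite !mxE (big_morph Im ImD Im0); apply: eq_bigr => i _.
    by rewrite !mxE; case: (v 0 i) => x y; rewrite /Im/= mulr0 add0r.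
  by rewrite vA !mxE; case: (v 0 j) => x y; rewrite [RHS]addrC; case: (z).
suff [a [x [x0 xA]]] : exists a (x : 'rV[R]_n.+1), x != 0 /\ x *m A = a *: x.
  have := sqnorm_gt0 x0; have := mx11_scalar (x *m x^T).
  set s := (x *m x^T) 0 0 => xx s0.
  exists a, ((Num.sqrt s)^-1 *: x); split; last first.
    by rewrite -scalemxAl xA !scalerA mulrC.
  rewrite linearZ/= -scalemxAl -scalemxAr scalerA xx.
  by rewrite scale_scalar_mx -expr2 exprVn sqr_sqrtr ?ltW// mulVf ?gt_eqF.
have uw0 : (u != 0) || (w != 0).
  rewrite -negb_and; apply: contra v0 => /andP[/eqP u0 /eqP w0].
  apply/eqP/rowP => j; rewrite mxE.
  have := congr1 (fun m : 'rV__ => m 0 j) u0.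
  have := congr1 (fun m : 'rV__ => m 0 j) w0.
  by rewrite !mxE; case: (v 0 j) => x y /= -> ->.
have uw : (u *m A *m w^T) 0 0 = (w *m A *m u^T) 0 0.
  by rewrite (mulmx_tr_comm (w *m A)) trmx_mul Asym mulmxA.
have b0 : Im z = 0.
  move: uw; rewrite uA wA mulmxBl mulmxDl -!scalemxAl (mulmx_tr_comm w u).
  have entries (X Y : 'M[R]_1) (c k : R) :
    (c *: X + k *: Y) 0 0 = c * X 0 0 + k * Y 0 0 by rewrite !mxE.
  rewrite -scaleNr !entries mulNr => /eqP; rewrite -subr_eq0.
  have -> : Re z * (u *m w^T) 0 0 - Im z * (w *m w^T) 0 0 -
    (Im z * (u *m u^T) 0 0 + Re z * (u *m w^T) 0 0) =
    - (Im z * ((u *m u^T) 0 0 + (w *m w^T) 0 0)) by ring.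
  rewrite oppr_eq0 mulf_eq0 paddr_eq0 ?sqnorm_ge0// !sqnorm_eq0.
  by case/orP => [/eqP//|]; rewrite -[_ && _]negbK negb_and uw0.
exists (Re z); case/orP: uw0 => [u0|w0]; [exists u|exists w].
  by rewrite uA b0 scale0r subr0.
by rewrite wA b0 scale0r add0r.
Qed.

(** Induction by deflation: a reflection carrying a unit eigenvector to the first basis vector [e]
    makes [e] an eigenvector of the conjugate [B]. The symmetry of [B] then makes it block diagonal,
    and the induction hypothesis treats the lower right block. The rows of [O] are the
    eigenvectors. *)
Lemma symmetric_spectral n (A : 'M[R]_n) : A^T = A ->
  exists (O : 'M[R]_n) (l : 'rV[R]_n),
    O *m O^T = 1%:M /\ A = O^T *m diag_mx l *m O.
Proof.
elim: n A => [A _|n IH A Asym].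
  by exists 0, 0; split; apply/matrixP => -[].
have [a [v [v1 vA]]] := symmetric_eigenvector Asym.
pose e : 'rV[R]_(1 + n) := row_mx 1%:M 0.
have ee : e *m e^T = 1%:M.
  by rewrite tr_row_mx mul_row_col trmx1 mulmx1 mul0mx addr0.
pose H : 'M[R]_(1 + n) := householder (v - e).
have vH : v *m H = e by apply: householder_swap; rewrite v1 ee.
have HH : H *m H = 1%:M by exact: householderK.
have eH : e *m H = v by rewrite -vH -mulmxA HH mulmx1.
pose B : 'M[R]_(1 + n) := H *m A *m H.
have Bsym : B^T = B by rewrite !trmx_mul householder_sym Asym mulmxA.
have eB : e *m B = a *: e by rewrite 2!mulmxA eH vA -scalemxAl vH.
have BE : B = block_mx a%:M 0 0 (drsubmx B).
  have := eB; rewrite -{1}(submxK B) mul_row_block !mul1mx !mul0mx !addr0.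
  rewrite /e scale_row_mx scaler0 scalemx1 => /eq_row_mx[Bul Bur].
  rewrite -[LHS]submxK Bul Bur; congr block_mx.
  by rewrite -[dlsubmx B]trmxK trmx_dlsub Bsym Bur trmx0.
have [ O [l [OO BlE]]] : exists (O : 'M[R]_n) (l : 'rV[R]_n),
    O *m O^T = 1%:M /\ drsubmx B = O^T *m diag_mx l *m O.
  by apply: IH; rewrite trmx_drsub Bsym.
pose C : 'M[R]_(1 + n) := block_mx 1%:M 0 0 O.
have CT : C^T = block_mx 1%:M 0 0 O^T by rewrite tr_block_mx !trmx0 trmx1.
have CC : C *m C^T = 1%:M.
  rewrite CT mulmx_block !mulmx0 !mul0mx mulmx1 OO.
  by rewrite !addr0 !add0r -scalar_mx_block.
have CB : C^T *m diag_mx (row_mx a%:M l) *m C = B.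
  rewrite BE BlE CT diag_mx_row.
  rewrite !mulmx_block !mulmx0 !mul0mx !mulmx1 !mul1mx !addr0 !add0r.
  congr block_mx; last exact: mul0mx.
  by apply/matrixP => i j; rewrite !mxE (ord1 i) (ord1 j) !eqxx.
exists (C *m H), (row_mx a%:M l); split.
  by rewrite trmx_mul householder_sym mulmxA -(mulmxA _ H H) HH mulmx1.
rewrite trmx_mul householder_sym !mulmxA -2!(mulmxA H) CB /B.
by rewrite !mulmxA HH mul1mx -mulmxA HH mulmx1.
Qed.

End SpectralTheorem.

(** In a full-rank factorization E = C D, idempotence cancels to D C = 1, an identity matrix of size
    the rank; the trace is cyclic. *)
Lemma mxtrace_idempotent (F : fieldType) n (E : 'M[F]_n) :
  E *m E = E -> \tr E = (\rank E)%:R.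
Proof.
have := row_base_free E; have := col_base_full E; have := mulmx_base E.
move: (col_base E) (row_base E) => C D CD Cfull Dfree EE.
rewrite -{1}CD mxtrace_mulC; suff -> : D *m C = 1%:M by rewrite mxtrace1.
apply: (row_full_inj Cfull); apply: (row_free_inj Dfree).
by rewrite /= mulmx1 mulmxA CD -mulmxA CD.
Qed.

Definition indicator_row (R : pzRingType) n (p : pred 'I_n) : 'rV[R]_n :=
  \row_i (p i)%:R.

Lemma rank_indicator (R : realFieldType) n (p : pred 'I_n) :
  \rank (diag_mx (indicator_row R p)) = #|p|.
Proof.
apply/eqP; rewrite -(eqr_nat R) -mxtrace_idempotent.
  rewrite mxtrace_diag -sum1_card natr_sum [eqbRHS]big_mkcond/=.
  by apply/eqP/eq_bigr => i _; rewrite mxE unfold_in; case: (p i).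
rewrite mulmx_diag; congr diag_mx; apply/rowP => i.
by rewrite !mxE -natrM mulnb andbb.
Qed.

(** * Weyl's inequality as a dimension count *)

Section EigenvalueCount.
Variable R : realFieldType.

(** The restriction [E] to the coordinates in [r] is injective on the span of the eigenvectors with
    eigenvalue at least [M]: a nonzero [u] in its kernel would have a Rayleigh quotient at least [M]
    and also below (M - k) + k. *)
Lemma count_eigenvalue_ge n (O K : 'M[R]_n) (l V : 'rV[R]_n) (k M : R) :
  O *m O^T = 1%:M ->
  O^T *m diag_mx l *m O = diag_mx V + K ->
  (forall u : 'rV[R]_n, (u *m K *m u^T) 0 0 <= k * (u *m u^T) 0 0) ->
  (#|[pred i | (M <= l 0 i)%R]| <= #|[pred j | (M - k <= V 0 j)%R]|)%N.
Proof.
move=> OO AE Kk.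
have OO' : O^T *m O = 1%:M by apply: mulmx1C.
have Ou : O \in unitmx by case/mulmx1_unit: OO.
set p := [pred i | _]; set r := [pred j | _].
rewrite -(rank_indicator R p) -(rank_indicator R r).
set D := diag_mx _; set E := diag_mx _.
have rDO : \rank (D *m O) = \rank D.
  by apply/eqP; rewrite eqn_leq mxrankM_maxl /= -{1}(mulmxK Ou D) mxrankM_maxl.
rewrite -rDO -(mxrank_mul_ker (D *m O) E).
suff -> : (D *m O :&: kermx E)%MS = 0 by rewrite mxrank0 addn0 mxrankM_maxr.
apply/eqP/rowV0P => u; rewrite sub_capmx.
move=> /andP[/submxP[c uE] /sub_kermxP uE0].
apply/eqP; rewrite -sqnorm_eq0; apply: contraTT isT => nu.
(* The coordinates of [u] in the eigenbasis; they vanish outside [p]. *)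
pose b := u *m O^T.
have bE : b = c *m D by rewrite /b uE -!mulmxA OO mulmx1.
have nb : (b *m b^T) 0 0 = (u *m u^T) 0 0.
  by rewrite /b trmx_mul trmxK mulmxA -(mulmxA u) OO' mulmx1.
have diagE (x y : 'rV[R]_n) : (x *m diag_mx y *m x^T) 0 0 =
    \sum_i y 0 i * x 0 i ^+ 2.
  rewrite mulmx_trE; apply: eq_bigr => i _.
  by rewrite mul_mx_diag mxE mulrAC mulrC expr2.
have lo : M * (u *m u^T) 0 0 <= (u *m (diag_mx V + K) *m u^T) 0 0.
  rewrite -AE !mulmxA -/b -(mulmxA _ O) -[ O *m u^T]trmxK trmx_mul trmxK -/b.
  rewrite diagE -nb mulmx_trE mulr_sumr; apply: ler_sum => i _.
  rewrite -expr2; have [pi|npi] := boolP (p i).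
    by apply: ler_wpM2r => //; exact: sqr_ge0.
  rewrite bE mul_mx_diag !mxE (negbTE npi) mulr0 expr0n/= !mulr0.
  exact: lexx.
have hi : (u *m (diag_mx V + K) *m u^T) 0 0 < M * (u *m u^T) 0 0.
  rewrite mulmxDr mulmxDl mxE -[M](subrK k) mulrDl.
  apply: ltr_leD (Kk u); rewrite diagE mulmx_trE mulr_sumr.
  have ur i : r i -> u 0 i = 0.
    move=> ri; have := congr1 (fun m : 'rV__ => m 0 i) uE0.
    by rewrite mul_mx_diag !mxE (_ : r i = true)// mulr1.
  (* The strict inequality comes from a nonzero coordinate, which necessarily lies outside [r]. *)
  have [j uj] : exists j, u 0 j != 0.
    apply/existsP; apply: contraNT nu => /existsPn u0.
    rewrite sqnorm_eq0; apply/eqP/rowP => j; rewrite mxE; apply/eqP.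
    by have := u0 j; rewrite negbK.
  rewrite (bigD1 j)//= [ltRHS](bigD1 j)//=; apply: ltr_leD.
    rewrite -expr2 ltr_pM2r ?exprn_even_gt0//= ltNge.
    by apply: contraNN uj => rj; rewrite ur.
  apply: ler_sum => i _; rewrite -expr2.
  have [ri|nri] := boolP (r i); first by rewrite ur// expr0n/= !mulr0.
  apply: ler_wpM2r; first exact: sqr_ge0.
  by rewrite ltW// ltNge.
by have := le_lt_trans lo hi; rewrite ltxx.
Qed.

Lemma count_eigenvalue_le n (O K : 'M[R]_n) (l V : 'rV[R]_n) (k M : R) :
  O *m O^T = 1%:M ->
  O^T *m diag_mx l *m O = diag_mx V + K ->
  (forall u : 'rV[R]_n, - k * (u *m u^T) 0 0 <= (u *m K *m u^T) 0 0) ->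
  (#|[pred i | (l 0 i <= M)%R]| <= #|[pred j | (V 0 j <= M + k)%R]|)%N.
Proof.
move=> OO AE Kk.
rewrite (@eq_card _ _ [pred i | - M <= (- l) 0 i]); last first.
  by move=> i; rewrite !inE mxE lerN2.
rewrite [leqRHS](@eq_card _ _ [pred i | - M - k <= (- V) 0 i]); last first.
  by move=> i; rewrite !inE mxE -opprD lerN2.
apply: (@count_eigenvalue_ge _ O (- K)) => // [|u].
  by rewrite !linearN/= mulNmx AE opprD.
by rewrite mulmxN mulNmx mxE lerNl -mulNr.
Qed.

End EigenvalueCount.

(** * Spectral measures *)

Section SpectralMeasure.
Variable R : realType.

Lemma conj_diagE n (O : 'M[R]_n) (y : 'rV[R]_n) j :
  (O^T *m diag_mx y *m O) j j = \sum_i y 0 i * O i j ^+ 2.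
Proof.
rewrite mxE; apply: eq_bigr => i _.
by rewrite mul_mx_diag !mxE mulrAC mulrC expr2.
Qed.

(** [Q] is symmetric, maps into the eigenspace and fixes it, so [1 - Q] maps into the orthogonal
    complement. The second conjunct lets [Q] decide which [x] are eigenvalues. *)
Lemma orthoproj_eigenspace n (O : 'M[R]_n) (l : 'rV[R]_n) x :
  O *m O^T = 1%:M ->
  let A := O^T *m diag_mx l *m O in
  let Q := O^T *m diag_mx (indicator_row R [pred i | l 0 i == x]) *m O in
  orthoproj (eigenspace A x) = Q /\ (eigenspace A x == 0) = (Q == 0).
Proof.
move=> OO A Q; have OO' : O^T *m O = 1%:M by apply: mulmx1C.
have QU : (Q <= eigenspace A x)%MS.
  apply/eigenspaceP; rewrite /Q /A !mulmxA -(mulmxA _ O O^T) OO mulmx1.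
  rewrite -(mulmxA O^T (diag_mx _) (diag_mx _)) mulmx_diag.
  rewrite scalemxAl scalemxAr -linearZ/=.
  congr (_ *m diag_mx _ *m _); apply/rowP => i; rewrite !mxE /=.
  by have [->|] := eqVneq (l 0 i) x; rewrite ?mul1r ?mulr1 ?mul0r ?mulr0.
have UQ : eigenspace A x *m Q = eigenspace A x.
  have /eigenspaceP UA := submx_refl (eigenspace A x).
  set U := eigenspace A x in UA *.
  (* In eigenbasis coordinates an eigenvector for [x] is supported where [l] equals [x]. *)
  pose Y := U *m O^T.
  have Yl : Y *m diag_mx l = x *: Y.
    have := congr1 (fun M => M *m O^T) UA.
    by rewrite /A !mulmxA -(mulmxA _ O O^T) OO mulmx1 -scalemxAl.
  rewrite /Q !mulmxA -/Y -[RHS]mulmx1 -OO' mulmxA -/Y; congr (_ *m _).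
  apply/matrixP => i j; rewrite mul_mx_diag !mxE /=.
  have := congr1 (fun M : 'M[R]_n => M i j) Yl; rewrite mul_mx_diag !mxE mulrC.
  have [_ _|lx /eqP] := eqVneq (l 0 j) x; first by rewrite mulr1.
  rewrite -subr_eq0 -mulrBl mulf_eq0 subr_eq0 (negbTE lx)/= => /eqP ->.
  by rewrite mul0r.
split; last first.
  apply/eqP/eqP => [U0|Q0]; last by rewrite -UQ Q0 mulmx0.
  by move: QU; rewrite U0 submx0 => /eqP.
move: QU UQ; rewrite /orthoproj; move: (eigenspace A x) => U QU UQ.
have QT : Q^T = Q by rewrite !trmx_mul trmxK tr_diag_mx mulmxA.
(* A vector in both spaces is orthogonal to itself. *)
have UW : (U :&: kermx U^T = 0)%MS.
  apply/eqP/rowV0P => u; rewrite sub_capmx.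
  move=> /andP[/submxP[c uE] /sub_kermxP uU].
  by apply/eqP; rewrite -sqnorm_eq0 {2}uE trmx_mul mulmxA uU mul0mx mxE.
rewrite -[LHS]mul1mx -(subrK Q 1%:M) mulmxDl addrC.
rewrite (proj_mx_id UW QU) proj_mx_0 ?addr0//.
by apply/sub_kermxP; rewrite mulmxBl mul1mx -{1}UQ trmx_mul QT subrr.
Qed.

Lemma spectral_measureE n (O : 'M[R]_n) (l : 'rV[R]_n) (B : set R) :
  O *m O^T = 1%:M ->
  spectral_measure (O^T *m diag_mx l *m O) B =
  O^T *m diag_mx (indicator_row R [pred i | l 0 i \in B]) *m O.
Proof.
move=> OO; set A := (X in spectral_measure X).
pose Q x := O^T *m diag_mx (indicator_row R [pred i | l 0 i == x]) *m O.
have PQ x : orthoproj (eigenspace A x) = Q x.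
  by have [] := orthoproj_eigenspace l x OO.
have UQ x : (eigenspace A x == 0) = (Q x == 0).
  by have [] := orthoproj_eigenspace l x OO.
(* Repeated entries of [l] are merged, since the spectral measure sums over each eigenvalue once. *)
pose s := [seq x <- undup [seq l 0 i | i : 'I_n] | x \in B].
have s_uniq : uniq s by rewrite filter_uniq ?undup_uniq.
rewrite /spectral_measure (eq_fsbigr Q)//.
rewrite (fsbig_widen _ [set` s])/=; last 2 first.
- move=> x [/= xA Bx]; rewrite /= mem_filter mem_undup (mem_set Bx)/=.
  apply: contraTT xA => xl; rewrite /eigenvalue negbK UQ.
  apply/eqP; rewrite /Q (_ : indicator_row _ _ = 0).
    by rewrite linear0 mulmx0 mul0mx.
  apply/rowP => i; rewrite !mxE /=; case: eqP => // lx.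
  by move: xl; rewrite -lx map_f// mem_enum.
- move=> x [/=]; rewrite mem_filter => /andP[/set_mem Bx _] nE.
  by apply/eqP; rewrite -UQ; apply: contra_notT nE => E0; split.
rewrite -fsbig_seq// /Q.
rewrite -mulmx_suml -mulmx_sumr; congr (_ *m _ *m _).
rewrite -linear_sum/=; congr diag_mx; apply/rowP => i.
rewrite summxE mxE /=; under eq_bigr do rewrite mxE /=.
have [Bl|Bl] := boolP (l 0 i \in B).
  rewrite (bigD1_seq (l 0 i))//=.
    by rewrite eqxx big1 ?addr0// => x /negbTE; rewrite eq_sym => ->.
  by rewrite mem_filter Bl mem_undup map_f// mem_enum.
rewrite big_seq big1// => x; rewrite mem_filter => /andP[Bx _].
by case: eqP => // lx; rewrite lx Bx in Bl.
Qed.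

Lemma spectral_measure_diag_ge0 n (A : 'M[R]_n) B j : A^T = A ->
  0 <= spectral_measure A B j j.
Proof.
move=> /symmetric_spectral [U [l [OO ->]]].
rewrite spectral_measureE// conj_diagE; apply: sumr_ge0 => i _.
by rewrite mulr_ge0 ?sqr_ge0// mxE.
Qed.

Lemma sum_pred_card (T : finType) (p : pred T) :
  \sum_(j : T) (p j)%:R = #|p|%:R :> R.
Proof.
rewrite -sum1_card natr_sum [RHS]big_mkcond/=.
by apply: eq_bigr => i _; rewrite unfold_in; case: (p i).
Qed.

Lemma spectral_measure_tr n (A : 'M[R]_n) (O : 'M[R]_n) (l : 'rV[R]_n) B :
  O *m O^T = 1%:M -> A = O^T *m diag_mx l *m O ->
  \tr (spectral_measure A B) = #|[pred i | l 0 i \in B]|%:R.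
Proof.
move=> OO ->; rewrite spectral_measureE// mxtrace_mulC mulmxA OO mul1mx.
rewrite mxtrace_diag; under eq_bigr do rewrite mxE.
exact: (sum_pred_card [pred i | l 0 i \in B]).
Qed.

(** The trace counts the eigenvalues in the two half-lines, and each half-line has its own counting
    bound. *)
Lemma spectral_measure_tr_outside n (K : 'M[R]_n) (V : 'rV[R]_n) (k M1 M2 : R) :
  K^T = K ->
  (forall u : 'rV[R]_n, `|(u *m K *m u^T) 0 0| <= k * (u *m u^T) 0 0) ->
  \tr (spectral_measure (diag_mx V + K) (`]-oo, M1] `|` `[M2, +oo[)) <=
  \sum_j ((V 0 j <= M1 + k)%R%:R + (M2 - k <= V 0 j)%R%:R).
Proof.
move=> KT Kk.
have [|O [l [OO AE]]] := @symmetric_spectral _ _ (diag_mx V + K).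
  by rewrite linearD/= tr_diag_mx KT.
rewrite (spectral_measure_tr _ OO AE) big_split/=.
rewrite (sum_pred_card [pred j | V 0 j <= M1 + k]).
rewrite (sum_pred_card [pred j | M2 - k <= V 0 j]).
rewrite -natrD ler_nat.
apply: (@leq_trans (#|[pred i | (l 0%R i <= M1)%R]| +
                    #|[pred i | (M2 <= l 0%R i)%R]|)).
  rewrite -[leqRHS]cardUI; apply: leq_trans (leq_addr _ _).
  apply/subset_leq_card/fintype.subsetP => i.
  rewrite unfold_in/= => /set_mem[]/=; rewrite in_itv/= ?andbT => lM.
    by apply/orP; left.
  by apply/orP; right.
apply: leq_add.
  apply: (@count_eigenvalue_le _ _ O K l V k M1 OO (esym AE)) => u.
  by have := Kk u; rewrite ler_norml => /andP[+ _]; rewrite mulNr.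
apply: (@count_eigenvalue_ge _ _ O K l V k M2 OO (esym AE)) => u.
by have := Kk u; rewrite ler_norml => /andP[].
Qed.

(* Chebyshev's inequality *)
Lemma spectral_measure_diag_ge n (A : 'M[R]_n) (B : set R) (c r : R) j :
  A^T = A -> 0 < r -> (forall x, ~ B x -> r <= `|x - c|) ->
  1 - (\sum_m (A - c%:M) j m ^+ 2) / r ^+ 2 <= spectral_measure A B j j.
Proof.
move=> AT r0 Br; have [U [l [OO AE]]] := symmetric_spectral AT.
have OO' : U^T *m U = 1%:M by apply: mulmx1C.
have AcE : A - c%:M = U^T *m diag_mx (l - const_mx c) *m U.
  rewrite linearB/= mulmxBr mulmxBl -AE; congr (_ - _).
  by rewrite diag_const_mx mul_mx_scalar -scalemxAl OO' scalemx1.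
(* The squared norm of row [j] of A - c is the second moment about [c] of the measure with mass
   [U i j ^+ 2] at [l 0 i]. *)
have -> : \sum_m (A - c%:M) j m ^+ 2 =
    \sum_i (l 0 i - c) ^+ 2 * U i j ^+ 2.
  have -> : \sum_m (A - c%:M) j m ^+ 2 = ((A - c%:M) *m (A - c%:M)^T) j j.
    by rewrite mxE; apply: eq_bigr => m _; rewrite !mxE expr2.
  rewrite AcE !trmx_mul trmxK tr_diag_mx !mulmxA -(mulmxA _ U U^T) OO mulmx1.
  rewrite -(mulmxA U^T (diag_mx _) (diag_mx _)) mulmx_diag.
  rewrite conj_diagE; apply: eq_bigr => i _.
  by rewrite !mxE expr2.
have <- : \sum_i U i j ^+ 2 = 1.
  transitivity ((U^T *m U) j j); last by rewrite OO' mxE eqxx.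
  by rewrite mxE; apply: eq_bigr => i _; rewrite mxE expr2.
rewrite AE spectral_measureE// conj_diagE mulr_suml -sumrB.
apply: ler_sum => i _; rewrite mxE/=.
have O2 := sqr_ge0 (U i j).
have [_|nB] := boolP (l 0 i \in B).
  rewrite mul1r lerBlDr lerDl.
  by apply: divr_ge0; [apply: mulr_ge0 => //|]; exact: sqr_ge0.
rewrite mul0r subr_le0 ler_pdivlMr ?exprn_gt0// mulrC.
apply: ler_wpM2r => //; rewrite -(real_normK (num_real (_ - _))).
apply: lerXn2r; rewrite ?nnegrE//; first exact: ltW.
by apply: Br => Bl; rewrite mem_set in nB.
Qed.

End SpectralMeasure.

(** * The finite-volume Hamiltonian *)

Section SchurTest.
Variable R : realFieldType.

(** The inequality |u_i u_j| <= (u_i^2 + u_j^2) / 2 reduces the quadratic form to row sums, which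
    the symmetry of [G] identifies with column sums. *)
Lemma schur_test n (G : 'M[R]_n) (k : R) (u : 'rV[R]_n) :
  G^T = G -> (forall i j, 0 <= G i j) -> (forall i, \sum_j G i j <= k) ->
  `|(u *m G *m u^T) 0 0| <= k * (u *m u^T) 0 0.
Proof.
move=> GT G0 Gk; have Gsym i j : G i j = G j i by rewrite -{1}GT mxE.
have sumG : \sum_i \sum_j G i j * u 0 i ^+ 2 <= k * (u *m u^T) 0 0.
  rewrite mulmx_trE mulr_sumr; apply: ler_sum => i _.
  by rewrite -mulr_suml -expr2; apply: ler_wpM2r => //; exact: sqr_ge0.
rewrite mulmx_trE; apply: le_trans sumG.
have -> : \sum_i \sum_j G i j * u 0 i ^+ 2 =
    \sum_j \sum_i G i j * ((u 0 i ^+ 2 + u 0 j ^+ 2) / 2).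
  set S := LHS.
  have S2 : S = \sum_j \sum_i G i j * u 0 i ^+ 2 by exact: exchange_big.
  have S3 : S = \sum_j \sum_i G i j * u 0 j ^+ 2.
    by apply: eq_bigr => i _; apply: eq_bigr => j _; rewrite Gsym.
  transitivity ((S + S) / 2); first by field.
  rewrite {1}S2 S3 -big_split/= mulr_suml; apply: eq_bigr => j _.
  rewrite -big_split/= mulr_suml; apply: eq_bigr => i _; ring.
apply: le_trans (ler_norm_sum _ _ _) _; apply: ler_sum => j _.
rewrite mxE mulr_suml; apply: le_trans (ler_norm_sum _ _ _) _.
apply: ler_sum => i _; rewrite mulrAC mulrC normrM ger0_norm//.
apply: ler_wpM2l => //; rewrite ler_norml.
have := sqr_ge0 (u 0 i - u 0 j); have := sqr_ge0 (u 0 i + u 0 j).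
by move=> h1 h2; apply/andP; split; lra.
Qed.

End SchurTest.

(** * Nearest neighbours and the adjacency matrix *)

Section Neighbours.
Variable R : realType.

Lemma enormN d (x : 'rV[int]_d) : enorm R (- x) = enorm R x.
Proof.
by congr Num.sqrt; apply: eq_bigr => i _; rewrite mxE mulrNz sqrrN.
Qed.

(** Squares of integers summing to 1 consist of a single 1 and zeros. *)
Lemma enorm_eq1 d (x : 'rV[int]_d) : enorm R x = 1 ->
  exists (i : 'I_d) (b : bool), x = (-1) ^+ b *: delta_mx 0 i.
Proof.
move=> x1; have S1 : \sum_i x 0 i ^+ 2 = 1.
  apply: (@intr_inj R); rewrite rmorph_sum/=.
  transitivity (enorm R x ^+ 2); last by rewrite x1 expr1n.
  rewrite sqr_sqrtr; first by apply: eq_bigr => i _; rewrite rmorphXn.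
  by apply: sumr_ge0 => i _; exact: sqr_ge0.
have [i xi] : exists i, x 0 i != 0.
  apply/existsP; apply: contra_eqT S1 => /existsPn x0.
  rewrite big1 1?eq_sym ?oner_eq0// => i _.
  by have := x0 i; rewrite negbK => /eqP ->; rewrite expr0n.
have xi1 : 1 <= x 0 i ^+ 2 by rewrite -gtz0_ge1 exprn_even_gt0.
have rest0 : 0 <= \sum_(j | j != i) x 0 j ^+ 2.
  by apply: sumr_ge0 => j _; exact: sqr_ge0.
move: S1; rewrite (bigD1 i)//= => S1.
have {}xi1 : x 0 i ^+ 2 = 1 by lra.
have xj j : j != i -> x 0 j = 0.
  have : \sum_(j | j != i) x 0 j ^+ 2 == 0 by apply/eqP; lra.
  rewrite psumr_eq0; last by move=> ? _; exact: sqr_ge0.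
  move=> /allP/(_ j); rewrite mem_index_enum => /(_ isT)/implyP + ji.
  by move=> /(_ ji); rewrite sqrf_eq0 => /eqP.
exists i, (x 0 i == -1); apply/rowP => j; rewrite !mxE eqxx/=.
have [->|/xj ->] := eqVneq j i; last by rewrite mulr0.
move/eqP: xi1; rewrite sqrf_eq1 => /orP[]/eqP ->; first by rewrite mulr1.
by rewrite eqxx expr1 mulr1.
Qed.

Lemma card_neighbours d (T : finType) (f : T -> 'rV[int]_d) n :
  injective f -> (#|[pred j | enorm R (f j - n) == 1%R]| <= 2 * d)%N.
Proof.
move=> finj.
pose h (p : 'I_d * bool) := n + (-1) ^+ p.2 *: delta_mx 0 p.1.
have <- : size (codom h) = (2 * d)%N.
  by rewrite size_codom card_prod card_ord card_bool mulnC.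
rewrite -(size_image f); apply: uniq_leq_size.
  by rewrite map_inj_uniq// enum_uniq.
move=> _ /mapP[j + ->]; rewrite mem_enum => jn.
have /eqP/enorm_eq1[i [b fE]] : enorm R (f j - n) == 1 by [].
apply/codomP; exists (i, b); rewrite /h/= -fE addrC subrK//.
Qed.

Definition site d (D : {fset 'rV[int]_d}) (i : 'I_#|{: D}|) : 'rV[int]_d :=
  val (enum_val i).

Definition adjacency d (D : {fset 'rV[int]_d}) : 'M[R]_#|{: D}| :=
  \matrix_(i, j) (enorm R (site j - site i) == 1)%:R.

Lemma adjacency_sym d (D : {fset 'rV[int]_d}) : (adjacency D)^T = adjacency D.
Proof. by apply/matrixP => i j; rewrite !mxE -enormN opprB. Qed.

Lemma adjacency_row_sum d (D : {fset 'rV[int]_d}) i :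
  \sum_j adjacency D i j <= 2 * d%:R.
Proof.
under eq_bigr do rewrite mxE.
rewrite (sum_pred_card R [pred j | enorm R (site j - site i) == 1]).
rewrite -natrM ler_nat; apply: card_neighbours.
by apply: inj_comp; [exact: val_inj | exact: enum_val_inj].
Qed.

Lemma finite_volumeE d (D : {fset 'rV[int]_d}) (a Q : 'rV[int]_d -> R) :
  finite_volume D (hamiltonian a Q) =
  diag_mx (\row_i (a (site i) * Q (site i))) + - adjacency D.
Proof.
apply/matrixP => i j; rewrite !mxE [RHS]addrC.
rewrite /hamiltonian -/(site i) -/(site j).
congr (_ + _); last first.
  rewrite /dirac_vec /site (inj_eq val_inj) (inj_eq enum_val_inj).
  by rewrite mulr_natr.
congr (- _); rewrite /laplacian /dirac_vec.
have [ij|ij] := eqVneq (enorm R (site j - site i)) 1.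
  rewrite (fsbigD1 (site j))//=; last first.
    exact: finite_neighbours.
  rewrite eqxx fsbig1 ?addr0// => m [_ /eqP/negbTE mj].
  by rewrite mj.
rewrite fsbig1// => m /= mi; case: eqP => // mj.
by move: ij; rewrite -mj mi eqxx.
Qed.

End Neighbours.

Section FiniteVolume.
Variables (R : realType) (d : nat) (D : {fset 'rV[int]_d}).
Variables (a Q : 'rV[int]_d -> R).
Let H := finite_volume D (hamiltonian a Q).

Let H_sym : H^T = H.
Proof.
by rewrite /H finite_volumeE linearD/= linearN/= tr_diag_mx adjacency_sym.
Qed.

Lemma local_spectral_ge0 (B : set R) (n : D) :
  0 <= spectral_measure H B (enum_rank n) (enum_rank n).
Proof. exact: spectral_measure_diag_ge0. Qed.

(** Summed over all sites, the diagonal entries form the trace; the Schur test supplies the constant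
    2d. *)
Lemma local_spectral_sum_le (M1 M2 : R) :
  \sum_(n : D) spectral_measure H (`]-oo, M1] `|` `[M2, +oo[)
                 (enum_rank n) (enum_rank n) <=
  \sum_(n : D) ((a (val n) * Q (val n) <= M1 + 2 * d%:R)%R%:R +
                (M2 - 2 * d%:R <= a (val n) * Q (val n))%R%:R).
Proof.
rewrite (reindex (@enum_val _ {: D}))/=; last first.
  by apply: onW_bij; exists enum_rank; [exact: enum_valK|exact: enum_rankK].
rewrite [leRHS](reindex (@enum_val _ {: D}))/=; last first.
  by apply: onW_bij; exists enum_rank; [exact: enum_valK|exact: enum_rankK].
under eq_bigr do rewrite enum_valK.
rewrite -[leLHS]/(\tr _) /H finite_volumeE.
apply: le_trans (@spectral_measure_tr_outside _ _ _ _ (2 * d%:R) _ _ _ _) _.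
- by rewrite linearN/= adjacency_sym.
- move=> u; rewrite mulmxN mulNmx mxE normrN; apply: schur_test.
  + exact: adjacency_sym.
  + by move=> i j; rewrite mxE.
  + exact: adjacency_row_sum.
by apply: ler_sum => j _; rewrite !mxE.
Qed.

Lemma local_spectral_ge (B : set R) (n : D) : (0 < d)%N ->
  (forall x, ~ B x -> 2 * d%:R <= `|x - a (val n) * Q (val n)|) ->
  2^-1 <= spectral_measure H B (enum_rank n) (enum_rank n).
Proof.
move=> d0 Bx; have d1 : 1 <= d%:R :> R by rewrite ler1n.
apply: le_trans (spectral_measure_diag_ge (enum_rank n) H_sym _ Bx); last first.
  by lra.
(* Subtracting the potential at [n] clears the diagonal entry of this row; the others are 0 or -1,
   so squaring them gives adjacency entries. *)
have -> : \sum_m (H - (a (val n) * Q (val n))%:M) (enum_rank n) m ^+ 2 =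
    \sum_m adjacency R D (enum_rank n) m.
  apply: eq_bigr => m _; rewrite /H finite_volumeE !mxE.
  by rewrite {1 2}/site enum_rankK addrAC subrr sub0r sqrrN; case: (_ == 1);
     rewrite ?expr1n ?expr0n.
(* Here 1 - 1/(2d) is at least 1/2 because d >= 1. *)
apply: (@le_trans _ _ (1 - (2 * d%:R) / (2 * d%:R) ^+ 2)).
  rewrite expr2 -[X in X - _]mulr1 invfM mulrA divff ?mul1r; last by lra.
  have : (2 * d%:R)^-1 <= 2^-1 :> R by rewrite lef_pV2 ?posrE//; lra.
  by lra.
rewrite lerD2l lerN2 ler_pM2r ?invr_gt0 ?exprn_gt0//; last by lra.
exact: adjacency_row_sum.
Qed.

End FiniteVolume.

(** * Lower integrals and the Pareto law *)

Section LowerIntegral.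
Context disp (T : measurableType disp) (R : realType).
Variable m : {measure set T -> \bar R}.
Local Open Scope ereal_scope.
Import HBNNSimple.

(* The library defines the integral of a nonnegative function, measurable or
   not, as a supremum over the simple functions below it, so that it is
   monotone and superadditive without measurability. *)
Lemma ge0_le_lower_integral (D : set T) (f g : T -> \bar R) :
  (forall x, D x -> 0 <= f x) -> (forall x, D x -> f x <= g x) ->
  \int[m]_(x in D) f x <= \int[m]_(x in D) g x.
Proof.
move=> f0 fg; rewrite !ge0_integralE//; last first.
  by move=> x Dx; exact: le_trans (f0 _ Dx) (fg _ Dx).
apply: ereal_sup_le => _ [h /= hf <-]; exists h => // x /=.
apply: le_trans (hf x) _; rewrite /patch; case: ifPn => // /set_mem.
exact: fg.
Qed.

(** Each [f i] is approximated from below by a simple function; integrals of simple functions add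
    up, and the sum of these functions stays below [g]. *)
Lemma sum_lower_integral_le (I : finType) (f : I -> T -> R) (g : T -> R) :
  (forall i x, 0 <= f i x)%R -> measurable_fun setT g ->
  (forall x, \sum_i f i x <= g x)%R ->
  \sum_i \int[m]_x (f i x)%:E <= \int[m]_x (g x)%:E.
Proof.
move=> f0 mg fg.
have g0 x : (0 <= g x)%R.
  by apply: le_trans (fg x); apply: sumr_ge0.
(* Once the integral of [g] is finite, so is that of every [f i], and near-optimal simple functions
   exist. *)
have [->|gfin] := eqVneq (\int[m]_x (g x)%:E) +oo; first by rewrite leey.
have fgi i x : (f i x <= g x)%R.
  apply: le_trans (fg x); rewrite (bigD1 i)//= lerDl.
  by apply: sumr_ge0.
have f_fin i : \int[m]_x (f i x)%:E \is a fin_num.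
  rewrite ge0_fin_numE; last by apply: integral_ge0 => x _; rewrite lee_fin.
  apply: (@le_lt_trans _ _ (\int[m]_x (g x)%:E)); last by rewrite ltey.
  by apply: ge0_le_lower_integral => x _; rewrite lee_fin.
apply/lee_addgt0Pr => e e0.
(* The added 1 keeps the divisor positive when [I] is empty. *)
pose k := (#|I|%:R + 1 : R)%R.
have k0 : (0 < k)%R by rewrite ltr_wpDl.
have approx i : exists h : {nnsfun T >-> R}, (forall x, h x <= f i x)%R /\
    \int[m]_x (f i x)%:E <= \int[m]_x (h x)%:E + (e / k)%:E.
  have ek : (0 < e / k)%R by rewrite divr_gt0.
  have := f_fin i; rewrite ge0_integralTE; last by move=> x; rewrite lee_fin.
  move=> /(ub_ereal_sup_adherent ek)[_ [h /= hf <-] hlt].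
  exists h; split; first by move=> x; rewrite -lee_fin; exact: hf.
  rewrite -leeBlDr//; apply: ltW; apply: lt_le_trans hlt _.
  by rewrite integral_nnsfun// patch_setT.
have [h hP] := choice approx.
apply: (@le_trans _ _ (\sum_i (\int[m]_x (h i x)%:E + (e / k)%:E))).
  by apply: lee_sum => i _; have [] := hP i.
rewrite big_split/=; apply: leeD.
  rewrite -ge0_integral_sum//; last 2 first.
  - by move=> i; apply/measurable_EFinP.
  - by move=> i x _; rewrite lee_fin.
  apply: ge0_le_lower_integral => x _.
    by apply: sume_ge0 => i _; rewrite lee_fin.
  rewrite sumEFin lee_fin; apply: le_trans (fg x).
  by apply: ler_sum => i _; have [] := hP i.
rewrite sumEFin lee_fin sumr_const.
rewrite -mulr_natr mulrAC -mulrA ger_pMr// ler_pdivrMr// mul1r.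
by rewrite lerDl.
Qed.

End LowerIntegral.

(** * Integrals of the Pareto density *)

Section ParetoDensity.
Variables (R : realType) (delta : R).
Hypothesis delta1 : 1 < delta.
Let mu := @lebesgue_measure R.

(** The formula of [rho] without the cutoff: it dominates [rho], agrees with it where |x| >= 1, and
    has an explicit integral away from 0. *)
Definition pareto (x : R) : R := (delta - 1) / 2 * `|x| `^ (- delta).

Lemma pareto_ge0 x : 0 <= pareto x.
Proof. by rewrite mulr_ge0 ?powR_ge0// divr_ge0// subr_ge0 ltW. Qed.

Lemma rho_ge0 x : 0 <= rho delta x.
Proof. by rewrite /rho; case: ifP => // _; exact: pareto_ge0. Qed.

Lemma rho_le_pareto x : rho delta x <= pareto x.
Proof. by rewrite /rho; case: ifP => // _; exact: pareto_ge0. Qed.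

Lemma rho_pareto x : 1 <= `|x| -> rho delta x = pareto x.
Proof. by rewrite /rho ltNge => ->. Qed.

Lemma continuous_powR_gt0 (p x : R) : 0 < x ->
  y `^ p @[y --> x] --> x `^ p.
Proof.
move=> x0; suff : {for x, continuous (fun y : R => y `^ p)} by [].
apply: differentiable_continuous; apply/derivable1_diffP.
by apply: derivable_powR; rewrite in_itv/= x0.
Qed.

Lemma continuous_pareto x : x != 0 -> pareto y @[y --> x] --> pareto x.
Proof.
move=> x0; apply: cvgM; first exact: cvg_cst.
have nx : y `^ (- delta) @[y --> `|x|] --> `|x| `^ (- delta).
  by apply: continuous_powR_gt0; rewrite normr_gt0.
by apply: cvg_comp nx; exact: norm_continuous.
Qed.

(** An antiderivative of [pareto] on the positive half-line, chosen to vanish at infinity. *)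
Let F (x : R) : R := - 2^-1 * x `^ (1 - delta).

Let derivable_F (x : R) : 0 < x -> is_derive x 1 F (pareto x).
Proof.
move=> x0; have -> : pareto x = - 2^-1 * ((1 - delta) * x `^ (1 - delta - 1)).
  rewrite /pareto gtr0_norm// (_ : 1 - delta - 1 = - delta); last by ring.
  by field.
by apply: is_deriveZ; exact: is_derive1_powR.
Qed.

Let continuous_F (x : R) : 0 < x -> F y @[y --> x] --> F x.
Proof.
by move=> x0; apply: cvgM; [exact: cvg_cst|exact: continuous_powR_gt0].
Qed.

Let F_cvg0 : F x @[x --> +oo] --> 0.
Proof.
rewrite -[X in _ --> X](mulr0 (- 2^-1)); apply: cvgM; first exact: cvg_cst.
(* The exponent 1 - delta is negative, so the limit at infinity becomes that of a positive power at
   0 from the right. *)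
apply: (@cvg_trans _ ((x^-1 `^ (delta - 1)) @[x --> +oo])).
  apply: near_eq_cvg; near=> x.
  have x0 : 0 < x by near: x; exact: nbhs_pinfty_gt.
  by rewrite -powR_inv1 ?ltW// -powRrM mulN1r opprB.
have p0 : x `^ (delta - 1) @[x --> (0 : R)^'+] --> 0.
  by apply: powR_cvg0; rewrite subr_gt0.
apply: cvg_comp p0 => A /= A0.
have V0 : x^-1 @[x --> (+oo : set_system R)] --> 0.
  by apply/gtr0_cvgV0; [exact: nbhs_pinfty_gt|exact: cvg_id].
have {}A0 := V0 _ A0; near=> x.
have : 0 < x^-1 by rewrite invr_gt0; near: x; exact: nbhs_pinfty_gt.
by near: x.
Unshelve. all: end_near. Qed.

Lemma integral_pareto_itvcy (s : R) : 0 < s ->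
  (\int[mu]_(x in `[s, +oo[) (pareto x)%:E = (2^-1 * s `^ (1 - delta))%:E)%E.
Proof.
move=> s0; have pos x : s <= x -> 0 < x by exact: lt_le_trans.
rewrite (@ge0_continuous_FTC2y _ _ F s 0)//.
- by rewrite /F mulNr sub0e -EFinN opprK.
- by move=> x _; exact: pareto_ge0.
- apply/continuous_within_itvcyP; split.
    move=> x; rewrite in_itv/= andbT => sx; apply: continuous_pareto.
    by rewrite gt_eqF// pos// ltW.
  by apply: cvg_at_right_filter; apply: continuous_pareto; rewrite gt_eqF.
- by move=> x sx; apply: ex_derive; apply: derivable_F; rewrite pos// ltW.
- by apply: cvg_at_right_filter; exact: continuous_F.
- move=> x; rewrite in_itv/= andbT => sx; rewrite derive1E.
  by have [] := derivable_F (pos _ (ltW sx)).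
Qed.

Lemma integral_pareto_itvcc (s t : R) : 0 < s -> s < t ->
  (\int[mu]_(x in `[s, t]) (pareto x)%:E =
   (2^-1 * (s `^ (1 - delta) - t `^ (1 - delta)))%:E)%E.
Proof.
move=> s0 st; have pos x : s <= x -> 0 < x by exact: lt_le_trans.
rewrite (@continuous_FTC2 _ _ F)//.
- by rewrite -EFinB /F; congr EFin; ring.
- apply/continuous_within_itvP => //; split.
  + move=> x; rewrite in_itv/= => /andP[sx _]; apply: continuous_pareto.
    by rewrite gt_eqF// pos// ltW.
  + by apply: cvg_at_right_filter; apply: continuous_pareto; rewrite gt_eqF.
  + apply: cvg_at_left_filter; apply: continuous_pareto.
    by rewrite gt_eqF// pos// ltW.
- split.
  + move=> x; rewrite in_itv/= => /andP[sx _].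
    by apply: ex_derive; apply: derivable_F; rewrite pos// ltW.
  + by apply: cvg_at_right_filter; exact: continuous_F.
  + by apply: cvg_at_left_filter; apply: continuous_F; rewrite pos// ltW.
- move=> x; rewrite in_itv/= => /andP[sx _]; rewrite derive1E.
  by have [] := derivable_F (pos _ (ltW sx)).
Qed.

Let paretoN x : (pareto \o -%R) x = pareto x.
Proof. by rewrite /pareto/= normrN. Qed.

Lemma integral_pareto_itvNyc (s : R) : 0 < s ->
  (\int[mu]_(x in `]-oo, (- s)%R]) (pareto x)%:E =
   (2^-1 * s `^ (1 - delta))%:E)%E.
Proof.
move=> s0; rewrite ge0_integration_by_substitutionNy.
- apply: etrans (integral_pareto_itvcy s0); apply: eq_integral => x _.
  by rewrite paretoN.
- apply/continuous_within_itvNycP; split.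
    move=> x; rewrite in_itv/= => xs; apply: continuous_pareto.
    by rewrite lt_eqF// (lt_trans xs)// oppr_lt0.
  apply: cvg_at_left_filter; apply: continuous_pareto.
  by rewrite oppr_eq0 gt_eqF.
- by move=> x _; exact: pareto_ge0.
Qed.

Lemma integral_pareto_itvNcc (s t : R) : 0 < s -> s < t ->
  (\int[mu]_(x in `[(- t)%R, (- s)%R]) (pareto x)%:E =
   (2^-1 * (s `^ (1 - delta) - t `^ (1 - delta)))%:E)%E.
Proof.
move=> s0 st; rewrite integration_by_substitution_oppr; last 2 first.
- exact: ltW.
- apply/continuous_within_itvP; first by rewrite ltrN2.
  split.
  + move=> x; rewrite in_itv/= => /andP[_ xs]; apply: continuous_pareto.
    by rewrite lt_eqF// (lt_trans xs)// oppr_lt0.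
  + apply: cvg_at_right_filter; apply: continuous_pareto.
    by rewrite oppr_eq0 gt_eqF// (lt_trans s0).
  + apply: cvg_at_left_filter; apply: continuous_pareto.
    by rewrite oppr_eq0 gt_eqF.
apply: etrans (integral_pareto_itvcc s0 st); apply: eq_integral => x _.
by rewrite paretoN.
Qed.

End ParetoDensity.

(** * Finding room inside a long interval *)

Section Intervals.
Variable R : realType.

Lemma itv_wide_points (I : interval R) (c : R) : 0 <= c ->
  (c%:E < lebesgue_measure [set` I])%E ->
  exists u v : R, [/\ u \in I, v \in I & c < v - u].
Proof.
move=> c0; rewrite lebesgue_measure_itv; case: ifPn => [_|_]; last first.
  by rewrite lte_fin ltNge c0.
case: I => [[b x|[|]] [b' y|[|]]]//= cI.
- move: cI; rewrite -EFinB lte_fin => cxy.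
  (* Cutting a third of the excess length off each end gives interior points, whichever endpoints
     belong to the interval, and leaves a distance above [c]. *)
  exists (x + (y - x - c) / 3), (y - (y - x - c) / 3).
  by split; [rewrite in_itv/=..|lra]; apply/andP; split;
     [case: b|case: b'|case: b|case: b'] => /=; lra.
- exists (x + 1), (x + c + 2).
  by split; [rewrite in_itv/= andbT..|lra]; case: b {cI} => /=; lra.
- exists (y - c - 2), (y - 1).
  by split; [rewrite in_itv/=..|lra]; case: b' {cI} => /=; lra.
- by exists 0, (c + 1); split; rewrite ?in_itv//=; lra.
Qed.

(* The interval is convex and avoids [[-c, c]], so two of its points further
   than [2 c] apart lie on the same side; moving them inwards by [c] leaves room
   for a potential value whose [c]-neighbourhood stays in the interval. *)
Lemma itv_inner (I : interval R) (c : R) : 0 <= c ->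
  [set` I] `<=` ~` `[- c, c] -> ((2 * c)%:E < lebesgue_measure [set` I])%E ->
  exists (s t : R) (J : set R), [/\ 0 < s, s < t,
    J = `[s, t]%classic \/ J = `[- t, - s]%classic &
    forall x y : R, J y -> ~ [set` I] x -> c <= `|x - y|].
Proof.
move=> c0 Ic cI; have [|u [v [uI vI uv]]] := itv_wide_points _ cI.
  by rewrite mulr_ge0.
have convex x : u <= x -> x <= v -> x \in I.
  move=> ux xv; apply: (@interval_is_interval _ I u v) => //.
  by rewrite ux xv.
have nIc x : - c <= x -> x <= c -> ~ (x \in I).
  by move=> cx xc /Ic; apply; rewrite /= in_itv/= cx xc.
have far (x y : R) : u + c <= y -> y <= v - c -> ~ (x \in I) -> c <= `|x - y|.
  move=> uy yv; apply: contra_notT; rewrite -ltNge ltr_norml => /andP[h1 h2].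
  by apply: convex; lra.
have [cu|uc] := ltP c u.
  exists (u + c), (v - c), `[u + c, v - c]%classic; split; [lra|lra|by left|].
  by move=> x y; rewrite /= in_itv/= => /andP[]; exact: far.
(* Otherwise [Num.max u (- c)] would lie both in [I] and in [-c, c]. *)
have vc : v < - c.
  rewrite ltNge; apply/negP => cv; apply: (nIc (Num.max u (- c))).
  - by rewrite le_max lexx orbT.
  - by rewrite ge_max uc/=; lra.
  - apply: convex; first by rewrite le_max lexx.
    by rewrite ge_max cv andbT; lra.
exists (c - v), (- (u + c)), `[u + c, v - c]%classic; split; [lra|lra| |].
  by right; rewrite opprK opprB.
by move=> x y; rewrite /= in_itv/= => /andP[]; exact: far.
Qed.

End Intervals.

(** * Probabilities for a rescaled Pareto variable *)

Section ParetoVariable.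
Context disp (Omega : measurableType disp) (R : realType).
Variables (P : probability Omega R) (X : {RV P >-> R}) (delta : R).
Hypothesis delta1 : 1 < delta.
Hypothesis Xdensity : forall B : set R, measurable B ->
  distribution P X B = (\int[lebesgue_measure]_(x in B) (rho delta x)%:E)%E.

(** Domination by [pareto] gives the bound also for [s] below the cutoff 1. *)
Lemma prob_ge (s : R) : 0 < s ->
  (P (X @^-1` `[s, +oo[) <= (2^-1 * s `^ (1 - delta))%:E)%E.
Proof.
move=> s0; rewrite -[leLHS]/(distribution P X `[s, +oo[) Xdensity//.
apply: le_trans; last by rewrite -(integral_pareto_itvcy delta1 s0).
apply: ge0_le_lower_integral => x _; rewrite lee_fin.
  exact: rho_ge0.
exact: rho_le_pareto.
Qed.

Lemma prob_le (s : R) : 0 < s ->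
  (P (X @^-1` `]-oo, (- s)%R]) <= (2^-1 * s `^ (1 - delta))%:E)%E.
Proof.
move=> s0; rewrite -[leLHS]/(distribution P X `]-oo, (- s)%R]) Xdensity//.
apply: le_trans; last by rewrite -(integral_pareto_itvNyc delta1 s0).
apply: ge0_le_lower_integral => x _; rewrite lee_fin.
  exact: rho_ge0.
exact: rho_le_pareto.
Qed.

Lemma prob_itv (s t : R) : 1 <= s -> s < t ->
  P (X @^-1` `[s, t]) = (2^-1 * (s `^ (1 - delta) - t `^ (1 - delta)))%:E.
Proof.
move=> s1 st; have s0 : 0 < s by apply: lt_le_trans s1.
rewrite -[LHS]/(distribution P X `[s, t]) Xdensity//.
rewrite -(integral_pareto_itvcc delta s0 st).
apply: eq_integral => x; rewrite inE/= in_itv/= => /andP[sx _].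
by rewrite rho_pareto// (le_trans s1)// (le_trans sx)// ler_norm.
Qed.

Lemma prob_itvN (s t : R) : 1 <= s -> s < t ->
  P (X @^-1` `[- t, - s]) = (2^-1 * (s `^ (1 - delta) - t `^ (1 - delta)))%:E.
Proof.
move=> s1 st; have s0 : 0 < s by apply: lt_le_trans s1.
rewrite -[LHS]/(distribution P X `[- t, - s]) Xdensity//.
rewrite -(integral_pareto_itvNcc delta s0 st).
apply: eq_integral => x; rewrite inE/= in_itv/= => /andP[_ xs].
rewrite rho_pareto// -normrN (le_trans s1)// (le_trans _ (ler_norm _))//.
by rewrite lerNr.
Qed.

(** Scaling by [a] splits off the factor a^(delta - 1), the summand of [betaL]. *)
Let powR_div (u a : R) : 0 < u -> 0 < a ->
  (u / a) `^ (1 - delta) = u `^ (1 - delta) * a `^ (delta - 1).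
Proof.
move=> u0 a0; rewrite powRM ?invr_ge0 ?ltW//; congr (_ * _).
by rewrite -powR_inv1 ?ltW// -powRrM mulN1r opprB.
Qed.

Variable a : R.
Hypothesis a0 : 0 < a.

Lemma prob_scaled_ge (u : R) : 0 < u ->
  (P [set w | (u <= a * X w)%R] <=
   (2^-1 * u `^ (1 - delta) * a `^ (delta - 1))%:E)%E.
Proof.
move=> u0; rewrite -mulrA -powR_div//.
rewrite (_ : [set _ | _] = X @^-1` `[u / a, +oo[).
  by rewrite prob_ge ?divr_gt0.
by apply/seteqP; split => w /=; rewrite in_itv/= andbT ler_pdivrMr// mulrC.
Qed.

Lemma prob_scaled_le (u : R) : 0 < u ->
  (P [set w | (a * X w <= - u)%R] <=
   (2^-1 * u `^ (1 - delta) * a `^ (delta - 1))%:E)%E.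
Proof.
move=> u0; rewrite -mulrA -powR_div//.
rewrite (_ : [set _ | _] = X @^-1` `]-oo, (- (u / a))%R]).
  by rewrite prob_le ?divr_gt0.
by apply/seteqP; split => w /=; rewrite in_itv/= -mulNr ler_pdivlMr// mulrC.
Qed.

(** The condition [a <= s] places the rescaled interval beyond the cutoff, where [rho] equals
    [pareto], so the probability is exact. *)
Lemma prob_scaled_itv (s t : R) (J : set R) : a <= s -> s < t ->
  J = `[s, t]%classic \/ J = `[- t, - s]%classic ->
  P [set w | J (a * X w)] =
  (2^-1 * (s `^ (1 - delta) - t `^ (1 - delta)) * a `^ (delta - 1))%:E.
Proof.
move=> sa st JE; have s0 : 0 < s by exact: lt_le_trans sa.
rewrite -mulrA mulrBl -!powR_div//; last exact: lt_trans st.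
case: JE => ->.
  rewrite -prob_itv ?ler_pdivlMr ?mul1r ?ltr_pM2r ?invr_gt0//.
  congr (P _); apply/seteqP; split => w /=; rewrite !in_itv/=.
    by rewrite ler_pdivrMr// ler_pdivlMr// mulrC.
  by rewrite ler_pdivrMr// ler_pdivlMr// mulrC.
rewrite -prob_itvN ?ler_pdivlMr ?mul1r ?ltr_pM2r ?invr_gt0//.
congr (P _); apply/seteqP; split => w /=; rewrite !in_itv/=.
  by rewrite -!mulNr ler_pdivrMr// ler_pdivlMr// mulrC.
by rewrite -!mulNr ler_pdivrMr// ler_pdivlMr// mulrC.
Qed.

End ParetoVariable.

(** * Bounds on the density of states *)

Section Boxes.
Variable R : realType.

Lemma big_fset_setD (K : choiceType) (A B : {fset K}) (f : K -> R) :
  (A `<=` B)%fset ->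
  \sum_(i <- B) f i = \sum_(i <- A) f i + \sum_(i <- (B `\` A)%fset) f i.
Proof.
move=> AB; rewrite (big_fsetID _ (mem A)); congr (_ + _).
  apply: eq_fbigl => i; rewrite !inE/=.
  by case: (boolP (i \in A)) => [/(fsubsetP AB)->|_]; rewrite ?andbF.
by apply: eq_fbigl => i; rewrite !inE/= andbC.
Qed.

Lemma le_sum_fset (K : choiceType) (A B : {fset K}) (f : K -> R) :
  (forall i, 0 <= f i) -> (A `<=` B)%fset ->
  \sum_(i <- A) f i <= \sum_(i <- B) f i.
Proof.
by move=> f0 AB; rewrite (big_fset_setD _ AB) lerDl; apply: sumr_ge0.
Qed.

Lemma box_le d (L M : nat) : (L <= M)%N -> (box d L `<=` box d M)%fset.
Proof.
move=> LM; apply/fsubsetP => n; rewrite !in_box => /forallP nL.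
by apply/forallP => i; rewrite (le_trans (nL i))// lez_nat.
Qed.

Lemma box_new_site d N : (0 < d)%N ->
  exists n, n \in (box d N.+1 `\` box d N)%fset.
Proof.
move=> d0; exists (const_mx N.+1%:Z); rewrite inE !in_box; apply/andP; split.
  apply/forallPn; exists (Ordinal d0); rewrite mxE -ltNge.
  by rewrite gtr0_norm// ltz_nat.
by apply/forallP => i; rewrite mxE gtr0_norm.
Qed.

Lemma enorm_notin_box d N (n : 'rV[int]_d) :
  n \notin box d N -> N%:R < enorm R n.
Proof.
rewrite in_box => /forallPn[i]; rewrite -ltNge => Ni.
apply: (@lt_le_trans _ _ `|(n 0 i)%:~R|).
  by rewrite -intr_norm -[ltLHS]/(N%:Z%:~R) ltr_int.
rewrite -sqrtr_sqr /enorm ler_wsqrtr// (bigD1 i)//= lerDl.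
by apply: sumr_ge0 => j _; exact: sqr_ge0.
Qed.

Lemma decay_small d (a : 'rV[int]_d -> R) (c alpha s : R) :
  0 < c -> 0 < alpha -> 0 < s ->
  (forall n, n != 0 -> a n <= c * enorm R n `^ (- alpha)) ->
  exists N, forall n, n \notin box d N -> a n <= s.
Proof.
move=> c0 alpha0 s0 decay.
(* The radius at which c K^(-alpha) equals [s]. *)
pose K := (c / s) `^ alpha^-1.
exists (Num.bound K) => n /enorm_notin_box nN.
have Kn : K < enorm R n.
  by apply: lt_trans nN; apply: archi_boundP; exact: powR_ge0.
have n_gt0 : 0 < enorm R n by apply: le_lt_trans Kn; exact: powR_ge0.
have n0 : n != 0.
  apply: contraTneq n_gt0 => ->; rewrite /enorm big1 ?sqrtr0 ?ltxx// => i _.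
  by rewrite mxE expr0n.
apply: le_trans (decay n n0) _; rewrite powRN ler_pdivrMr ?powR_gt0//.
rewrite mulrC -ler_pdivrMr//.
have -> : c / s = K `^ alpha.
  by rewrite -powRrM mulVf ?gt_eqF// powRr1// ltW// divr_gt0.
by apply: ge0_ler_powR; rewrite ?nnegrE ?powR_ge0 ?ltW.
Qed.

End Boxes.

Section LimitBounds.
Variable R : realType.
Local Open Scope ereal_scope.

Lemma limn_esup_le (u : nat -> \bar R) (c : \bar R) :
  (forall n, u n <= c) -> limn_esup u <= c.
Proof.
move=> uc; rewrite limn_esup_lim; apply: lime_le; first exact: is_cvg_esups.
by apply: nearW => n; apply: ge_ereal_sup => _ [k _ <-].
Qed.

Lemma limn_einf_ge (u : nat -> \bar R) (c : \bar R) N :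
  (forall n, (N <= n)%N -> c <= u n) -> c <= limn_einf u.
Proof.
move=> uc; rewrite limn_einf_lim; apply: lime_ge; first exact: is_cvg_einfs.
near=> n; apply: le_ereal_inf_tmp => _ [k nk <-]; apply: uc.
by apply: leq_trans nk; near: n; exists N.
Unshelve. all: by end_near. Qed.

End LimitBounds.

Section Bounds.
Variables (R : realType) (d : nat) (delta : R).
Hypotheses (d_gt0 : (0 < d)%N) (delta1 : 1 < delta).
Context disp (Omega : measurableType disp).
Variables (P : probability Omega R) (q : 'rV[int]_d -> {RV P >-> R}).
Hypothesis qdistr : forall (n : 'rV[int]_d) (B : set R), measurable B ->
  distribution P (q n) B =
  (\int[lebesgue_measure]_(x in B) (rho delta x)%:E)%E.
Variable a : 'rV[int]_d -> R.
Hypothesis apos : forall n, 0 < a n.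

Let localE (L : nat) (B : set R) (n : box d L) (w : Omega) : R :=
  spectral_measure
    (finite_volume (box d L) (hamiltonian a (fun m => q m w))) B
    (enum_rank n) (enum_rank n).

Lemma gammaLE L B : gammaL P a q delta L B =
  (((betaL a delta L)^-1)%:E *
   \sum_(n : box d L) \int[P]_w (localE B n w)%:E)%E.
Proof. by rewrite /gammaL; under eq_bigr do rewrite unlock. Qed.

Lemma betaL_gt0 L : 0 < betaL a delta L.
Proof.
rewrite /betaL (big_fsetD1 0)/=; last first.
  by rewrite in_box; apply/forallP => i; rewrite mxE normr0.
rewrite ltr_wpDr ?powR_gt0//.
by apply: sumr_ge0 => n _; exact: powR_ge0.
Qed.

Lemma measurable_potential n (J : set R) : measurable J ->
  measurable [set w | J (a n * q n w)].
Proof.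
move=> mJ; rewrite -[X in measurable X]setTI.
exact: (measurable_funM (measurable_cst (a n)) (measurable_funPT (q n))).
Qed.

Lemma gammaL_outside_le L (M1 M2 : R) : M1 < - (2 * d%:R) -> 2 * d%:R < M2 ->
  (gammaL P a q delta L (`]-oo, M1] `|` `[M2, +oo[) <=
   (1 / 2 * (1 / (- (2 * d%:R) - M1) `^ (delta - 1) +
             1 / (M2 - 2 * d%:R) `^ (delta - 1)))%:E)%E.
Proof.
move=> hM1 hM2; set u := - (2 * d%:R) - M1; set v := M2 - 2 * d%:R.
have u0 : 0 < u by rewrite subr_gt0.
have v0 : 0 < v by rewrite subr_gt0.
pose A n := [set w | a n * q n w <= - u].
pose B n := [set w | v <= a n * q n w].
have mA n : measurable (A n).
  rewrite (_ : A n = [set w | (`]-oo, - u]%classic : set R) (a n * q n w)]).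
    exact: measurable_potential.
  by apply/seteqP; split => w; rewrite /A/= in_itv.
have mB n : measurable (B n).
  rewrite (_ : B n = [set w | (`[v, +oo[%classic : set R) (a n * q n w)]).
    exact: measurable_potential.
  by apply/seteqP; split => w; rewrite /B/= in_itv/= andbT.
rewrite gammaLE muleC lee_pdivrMr ?betaL_gt0//.
(* Superadditivity moves the sum inside the integral, where the eigenvalue count holds for each
   outcome and its majorant is a measurable sum of indicators. *)
apply: (@le_trans _ _ (\int[P]_w
    (\sum_(n : box d L) (\1_(A (val n)) w + \1_(B (val n)) w : R))%:E)%E).
  apply: sum_lower_integral_le.
  - by move=> n w; exact: local_spectral_ge0.
  - apply: measurable_sum => n; apply: measurable_funD;
      exact: measurable_indic.
  - move=> w; 
    apply: le_trans (@local_spectral_sum_le R d (box d L) a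
      (fun m => q m w) M1 M2) _.
    apply: ler_sum => n _; rewrite !indicE !mem_setE/=.
    by rewrite /A /B /u opprB opprK lexx.
under eq_integral do rewrite -sumEFin.
rewrite ge0_integral_sum//; last first.
  by move=> n; apply/measurable_EFinP; apply: measurable_funD;
    exact: measurable_indic.
rewrite /betaL big_seq_fsetE/= -EFinM mulr_sumr -sumEFin.
apply: lee_sum => n _.
under eq_integral do rewrite EFinD.
rewrite ge0_integralD//; [|exact/measurable_EFinP/measurable_indic..].
rewrite !integral_indic// !setIT.
apply: le_trans (leeD (prob_scaled_le delta1 (qdistr (val n)) (apos _) u0)
  (prob_scaled_ge delta1 (qdistr (val n)) (apos _) v0)) _.
rewrite -EFinD lee_fin -mulrDl -mulrDr !div1r -!powRN !opprB.
exact: lexx.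
Qed.

(** Half the indicator of the event that the potential at [n] lies in [J] is a measurable minorant
    of the local spectral weight. *)
Lemma local_integral_ge L (B J : set R) (n : box d L) : measurable J ->
  (forall x y : R, J y -> ~ B x -> 2 * d%:R <= `|x - y|) ->
  (2^-1%:E * P [set w | J (a (val n) * q (val n) w)%R] <=
   \int[P]_w (localE B n w)%:E)%E.
Proof.
move=> mJ BJ; set A := [set w | _].
have mA : measurable A by exact: measurable_potential.
have -> : (2^-1%:E * P A = \int[P]_w (2^-1 * \1_A w)%:E)%E.
  rewrite (@integralZl_indic _ _ _ _ setT _ (fun=> A))//.
    by rewrite integral_indic// setIT.
  by rewrite ltNge invr_ge0 ler0n.
apply: ge0_le_lower_integral => w _; rewrite lee_fin.
  by rewrite mulr_ge0// invr_ge0.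
rewrite indicE; case: (boolP (w \in A)) => [/set_mem Aw|_].
  by rewrite mulr1; apply: local_spectral_ge => // x; exact: BJ.
by rewrite mulr0; exact: local_spectral_ge0.
Qed.

Lemma gammaL_ge (I : interval R) (c alpha : R) : 0 < c -> 0 < alpha ->
  (forall n, n != 0 -> a n <= c * enorm R n `^ (- alpha)) ->
  [set` I] `<=` ~` `[- (2 * d%:R), 2 * d%:R] ->
  ((4 * d%:R)%:E < lebesgue_measure [set` I])%E ->
  exists C : R, 0 < C /\
    (C%:E <= limn_einf (fun L : nat => gammaL P a q delta L [set` I]))%E.
Proof.
move=> c0 alpha0 decay Id Isize.
have [||s [t [J [s0 st JE JI]]]] := @itv_inner _ I (2 * d%:R) _ Id.
- by rewrite mulr_ge0.
- by rewrite mulrA -natrM.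
have mJ : measurable J by case: JE => ->.
have [N small] := decay_small c0 alpha0 s0 decay.
(* For [n] outside [box d N], the potential lies in [J] with probability k a_n^(delta - 1). *)
pose k := 2^-1 * (s `^ (1 - delta) - t `^ (1 - delta)).
have k0 : 0 < k.
  rewrite mulr_gt0// subr_gt0 -(opprB delta 1) !powRN.
  have t0 := lt_trans s0 st.
  rewrite ltf_pV2 ?posrE ?powR_gt0//.
  by apply: gt0_ltr_powR; rewrite ?subr_gt0 ?nnegrE ?ltW.
pose f n := a n `^ (delta - 1).
have f0 n : 0 <= f n by exact: powR_ge0.
pose b := \sum_(n <- box d N) f n.
pose g L := \sum_(n <- (box d L `\` box d N)%fset) f n.
have b0 : 0 <= b by exact: sumr_ge0.
(* The box of size [N.+1] is the first to contain a site outside [box d N], which makes the final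
   constant positive. *)
have g0 : 0 < g N.+1.
  have [n nN] := box_new_site N d_gt0.
  rewrite /g (big_fsetD1 n)//= ltr_wpDr ?powR_gt0//.
  exact: sumr_ge0.
(* [b] is fixed and [g] is nondecreasing, hence so is the proportion
   [g L / (g L + b)] of the good sites in [betaL]. *)
exists (2^-1 * k * g N.+1 / (g N.+1 + b)); split.
  apply: divr_gt0; first by apply: mulr_gt0 => //; apply: mulr_gt0.
  exact: ltr_wpDr.
apply: (@limn_einf_ge _ _ _ N.+1) => L NL.
have betaE : betaL a delta L = b + g L.
  by rewrite /betaL (big_fset_setD _ (box_le d (ltnW NL))).
have gL : g N.+1 <= g L.
  by apply: le_sum_fset => //; apply: fsetSD; exact: box_le.
have sumE : ((2^-1 * k * g L)%:E <=
    \sum_(n : box d L) \int[P]_w (localE [set` I] n w)%:E)%E.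
  (* Sites of the fixed box, where [a n] may exceed [s], are estimated by 0. *)
  pose h n := if n \in box d N then 0 else f n.
  have -> : g L = \sum_(n <- box d L) h n.
    rewrite (big_fset_setD _ (box_le d (ltnW NL))) big_seq big1 ?add0r.
      rewrite /g big_seq [RHS]big_seq; apply: eq_bigr => n.
      by rewrite inE => /andP[/negbTE nN _]; rewrite /h nN.
    by move=> n nN; rewrite /h nN.
  rewrite big_seq_fsetE/= mulr_sumr -sumEFin; apply: lee_sum => n _.
  rewrite /h; case: ifPn => [_|nN].
    rewrite mulr0; apply: integral_ge0 => w _.
    by rewrite lee_fin; exact: local_spectral_ge0.
  apply: le_trans (local_integral_ge n mJ JI).
  rewrite (prob_scaled_itv (qdistr (val n)) (apos _) (small _ nN) st JE).
  by rewrite -EFinM lee_fin -mulrA; exact: lexx.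
rewrite gammaLE muleC lee_pdivlMr ?betaL_gt0//.
apply: le_trans sumE; rewrite -EFinM lee_fin betaE.
have gb : 0 < g N.+1 + b by rewrite ltr_wpDr.
(* After clearing denominators, the difference of the two sides is a nonnegative multiple of
   [g L - g N.+1]. *)
rewrite mulrAC ler_pdivrMr// -subr_ge0.
have -> : 2^-1 * k * g L * (g N.+1 + b) - 2^-1 * k * g N.+1 * (b + g L) =
    2^-1 * k * b * (g L - g N.+1) by ring.
apply: mulr_ge0; last by rewrite subr_ge0.
by apply: mulr_ge0 => //; apply: mulr_ge0 => //; exact: ltW.
Qed.

End Bounds.

Unset Implicit Arguments.

Theorem corollary1p6 (R : realType) (d : nat) (hd : (1 <= d)%N)
    (alpha delta : R) (halpha : 0 < alpha) (hdelta : 1 < delta)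
    (hdim : 0 < d%:R - alpha * (delta - 1))
    (disp : measure_display) (Omega : measurableType disp)
    (P : probability Omega R)
    (q : 'rV[int]_d -> {RV P >-> R})
    (qindep : mutually_independent q)
    (qdistr : forall (n : 'rV[int]_d) (B : set R), measurable B ->
       distribution P (q n) B =
       (\int[lebesgue_measure]_(x in B) (rho delta x)%:E)%E)
    (a : 'rV[int]_d -> R) (apos : forall n, 0 < a n)
    (adecay : exists c1 c2 : R, 0 < c1 /\ c1 <= c2 /\
       forall n : 'rV[int]_d, n != 0 ->
         c1 * enorm R n `^ (- alpha) <= a n <= c2 * enorm R n `^ (- alpha)) :
  (forall M1 M2 : R, M1 < - (2 * d%:R) -> 2 * d%:R < M2 ->
     (limn_esup (fun L : nat =>
        gammaL P a q delta L (`]-oo, M1] `|` `[M2, +oo[)) <=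
      (1 / 2 * (1 / (- (2 * d%:R) - M1) `^ (delta - 1) +
                1 / (M2 - 2 * d%:R) `^ (delta - 1)))%:E)%E) /\
  (forall I : interval R,
     [set` I] `<=` ~` `[- (2 * d%:R), 2 * d%:R] ->
     ((4 * d%:R)%:E < lebesgue_measure [set` I])%E ->
     exists C : R, 0 < C /\
       (C%:E <= limn_einf (fun L : nat => gammaL P a q delta L [set` I]))%E).
Proof.
have [c1 [c2 [c1_gt0 [c12 decay]]]] := adecay; split.
  move=> M1 M2 hM1 hM2; apply: limn_esup_le => L.
  exact: gammaL_outside_le.
move=> I Id Isize; apply: (gammaL_ge hd hdelta qdistr apos _ halpha) Id Isize.
  exact: lt_le_trans c12.
by move=> n /decay/andP[].
Qed.
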